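(* Let a processing chain ($B$, $L$, $M_j$, $N_j$, $T_j$, $c_j$, $g_j$, $k_j$ with stride products $k_j^*$) be given whose application in a strided fashion is well-defined. Let $D\in\mathbb{N}_1$, $D\ge B$, be such that $D-B+1$ is divisible by $k_L^*$, and let $\xi\in M_0^D$. Then the application of the processing chain in a sliding fashion to $\xi$ (that is, $\mathrm{EvalSlide}_j(\xi)$ for all $j\in\{0,\dots,L\}$) is well-defined. For $j\in\{0,\dots,L\}$ put $u_j:=\dim_{M_j}(\mathrm{EvalStride}_j(\mathrm{Subsignal}_B(\xi,i)))\in\mathbb{N}_1$ (which is independent of the subsignal index $i$), $U_j^{\mathrm{col}}:=\mathrm{cdim}_{M_j}(\mathrm{EvalSlide}_j(\xi))$ and $U_j^{\mathrm{row}}:=\mathrm{rdim}_{M_j}(\mathrm{EvalSlide}_j(\xi))$. Then for all $j\in\{0,\dots,L\}$: (a) $u_j=\frac{1}{k_j^*}\big(B-\sum_{\mu=1}^jk_{\mu-1}^*(c_\mu-1)\big)$. (b) $U_j^{\mathrm{row}}=\frac{1}{k_j^*}\big(D-k_j^*+1-\sum_{\mu=1}^jk_{\mu-1}^*(c_\mu-1)\big)$ and $U_j^{\mathrm{col}}=k_j^*$. (c) $U_j^{\mathrm{row}}-u_j+1=\frac{1}{k_j^*}(D-B+1)$. (d) For all $i\in\{1,\dots,D-B+1\}$ and $\mu\in\{1,\dots,u_j\}$, $$\mathrm{EvalStride}_j(\mathrm{Subsignal}_B(\xi,i))_\mu=\mathrm{EvalSlide}_j(\xi)_{\mathrm{div}(i-1,k_j^*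 )+\mu,\ \mathrm{rem}(i-1,k_j^* )+1}.$$
   Context: $\mathbb{N}=\{0,1,2,\dots\}$, $\mathbb{N}_1=\mathbb{N}\setminus\{0\}$; $\{a,\dots,b\}$ is a set of integers (empty if $b<a$). Elements of $M^q$ are signals with $q$ samples, $\dim_M(\xi)=q$ for $\xi\in M^q$, $\cup_c(M):=\bigcup_{q\ge c}M^q$; $M^1$ is identified with $M$. For $a\in\mathbb{N}$, $b\in\mathbb{N}_1$, $\mathrm{div}(a,b)$ and $\mathrm{rem}(a,b)\in\{0,\dots,b-1\}$ denote Euclidean quotient and remainder. $\mathrm{Subsignal}_d(\xi,i):=(\xi_i,\dots,\xi_{i+d-1})$ for $i\in\{1,\dots,\dim_M(\xi)-d+1\}$. A function $T\colon\cup_c(M)\to\cup_1(N)$ is a subsignal compatible transformation with dimensionality reduction constant $c\in\mathbb{N}_1$ iff $\dim_N(T(\xi))=\dim_M(\xi)-c+1$ for all $\xi\in\cup_c(M)$, and for all $d\ge c$, $\xi\in\cup_d(M)$, $i\in\{1,\dots,\dim_M(\xi)-d+1\}$: $T(\mathrm{Subsignal}_d(\xi,i))=\mathrm{Subsignal}_{d-c+1}(T(\xi),i)$. For $f\colon M^c\to N$, $\mathrm{Slide}_f\colon\cup_c(M)\to\cup_1(N)$, $\mathrm{Slide}_f(\xi)_i:=f(\mathrm{Subsignal}_c(\xi,i))$, $i\in\{1,\dots,\dim_M(\xi)-c+1\}$. For $g\colon M^k\to N$, $\mathrm{Stride}_g$ is defined on signals whose length is a positive multiple of $k$ by $\mathrm{Stride}_g(\xi)_i:=g(\mathrm{Subsignal}_k(\xi,k(i-1)+1))$,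 $i\in\{1,\dots,\dim_M(\xi)/k\}$. Fragmented signals are matrices $\xi\in M^{a\times b}$ ($b$ columns = fragments, each with $a$ samples); $\mathrm{rdim}_M(\xi)=a$, $\mathrm{cdim}_M(\xi)=b$; $\xi_{i,j}$ is the entry in row $i$, column $j$. A signal in $M^D$ is identified with a matrix in $M^{D\times1}$. Subsignal compatible transformations and $\mathrm{Slide}$ operators are applied to a fragmented signal column by column. With $\mathrm{vec}_{a\times b}\colon M^{a\times b}\to M^{ab}$ stacking the columns on top of each other, for $k,q,s\in\mathbb{N}_1$: $\mathrm{Frag}_k\colon M^{kq\times s}\to M^{q\times ks}$, $\mathrm{Frag}_k(\xi):=(\mathrm{vec}^{-1}_{ks\times q}(\mathrm{vec}_{s\times kq}(\xi^T)))^T$. A processing chain consists of: $B\in\mathbb{N}_1$, a number of layers $L\in\mathbb{N}_1$, sets $M_0,\dots,M_L,N_1,\dots,N_L$, and for each $j\in\{1,\dots,L\}$ a subsignal compatible transformation $T_j\colon\cup_{c_j}(M_{j-1})\to\cup_1(N_j)$ with dimensionality reduction constant $c_j\in\mathbb{N}_1$ and a function $g_j\colon N_j^{k_j}\to M_j$ with $k_j\in\mathbb{N}_1$. Stride products: $k_j^*:=\prod_{\nu=1}^jk_\nu$ for $j\in\{0,\dots,L\}$ ($k_0^*=1$). Define recursively, for $\rho\in M_0^B$, $\mathrm{EvalStride}_0(\rho):=\rho$, $\mathrm{EvalStride}_j(\rho):=\mathrm{Stride}_{g_j}(T_j(\mathrm{EvalStride}_{j-1}(\rho)))$ for $j\ge1$;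 and for $\xi\in\cup_B(M_0)$, $\mathrm{EvalSlide}_0(\xi):=\xi$, $\mathrm{EvalSlide}_j(\xi):=\mathrm{Frag}_{k_j}(\mathrm{Slide}_{g_j}(T_j(\mathrm{EvalSlide}_{j-1}(\xi))))$ for $j\ge1$; these are well-defined only when every operator involved is applicable to its argument. The application in a strided fashion is called well-defined if for all $j\in\{1,\dots,L\}$ and all $\rho\in M_0^B$, every operator is applicable, i.e. in particular $k_j$ divides $\dim_{N_j}(T_j(\mathrm{EvalStride}_{j-1}(\rho)))$, and $\mathrm{EvalStride}_j(\rho)$ is non-empty. *)

(* Defs.v *)
(* MathComp world. *)
From HB Require Import structures.
From mathcomp Require Import all_boot all_order all_algebra.

Set Implicit Arguments.
Unset Strict Implicit.
Unset Printing Implicit Defensive.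

(* A signal with q samples in the set M is a q.-tuple M; a signal of
   unspecified length is a sequence. Sample, row and column indices start at 0
   throughout, where the usual mathematical notation starts at 1. *)

(* \cup_c(M), the signals with at least c samples *)
Record signal (c : nat) (M : Type) :=
  Signal { samples :> seq M; _ : c <= size samples }.
HB.instance Definition _ c M := [isSub for @samples c M].

Definition subsignal (M : Type) (d : nat) (s : seq M) (i : nat) : seq M :=
  take d (drop i s).

(* The ordinals below q.+1 - d are exactly the admissible positions 0 .. q - d
   (there is none if q < d). *)
Lemma size_subsignal (M : Type) (d q : nat) (s : q.-tuple M)
  (i : 'I_(q.+1 - d)) : size (subsignal d s i) == d.
Proof.
move: (ltn_ord i); rewrite ltn_subRL ltnS => le_q.
rewrite size_takel // size_drop size_tuple -(leq_add2r i) subnK //.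
exact: leq_trans (leq_addl _ _) le_q.
Qed.

Definition Subsignal (M : Type) (d q : nat) (s : q.-tuple M)
  (i : 'I_(q.+1 - d)) : d.-tuple M := Tuple (size_subsignal s i).

Lemma tuple_signal_subproof (M : Type) (c d : nat) (le_cd : c <= d)
  (s : d.-tuple M) : c <= size s.
Proof. by rewrite size_tuple. Qed.

Definition tuple_signal (M : Type) (c d : nat) (le_cd : c <= d)
  (s : d.-tuple M) : signal c M := Signal (tuple_signal_subproof le_cd s).

(* The existence of i forces xi to have at least d samples. *)
Definition subsignal_compatible (c : nat) (M N : Type)
    (T : signal c M -> signal 1 N) : Prop :=
  (forall xi : signal c M, size (T xi) = size xi - c + 1) /\
  (forall (d : nat) (le_cd : c <= d) (xi : signal c M)
      (i : 'I_((size xi).+1 - d)),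
    T (tuple_signal le_cd (Subsignal (in_tuple xi) i)) =
    subsignal (d - c + 1) (T xi) i :> seq N).

Record transformation (c : nat) (M N : Type) := Transformation {
  trans_fun :> signal c M -> signal 1 N;
  transP : subsignal_compatible trans_fun
}.

(* Slide and Stride on signals with exactly q samples; the first result has
   q - k + 1 samples if k <= q. *)
Definition Slide (k : nat) (M N : Type) (f : k.-tuple M -> N) (q : nat)
    (s : q.-tuple M) : (q.+1 - k).-tuple N :=
  [tuple f (Subsignal s i) | i < q.+1 - k].

Lemma stride_pos_subproof (k q : nat) (i : 'I_(q %/ k)) : k * i < q.+1 - k.
Proof.
rewrite ltn_subRL ltnS -mulnS mulnC.
by apply: leq_trans (leq_divM q k); rewrite leq_mul2r ltn_ord orbT.
Qed.

Definition stride_pos (k q : nat) (i : 'I_(q %/ k)) : 'I_(q.+1 - k) :=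
  Ordinal (stride_pos_subproof i).

Definition Stride (k : nat) (M N : Type) (g : k.-tuple M -> N) (q : nat)
    (s : q.-tuple M) : (q %/ k).-tuple N :=
  [tuple g (Subsignal s (stride_pos i)) | i < q %/ k].

(* A fragmented signal of arbitrary dimensions; its columns are the fragments. *)
Record fsignal (M : Type) := FSignal {
  rdim : nat;
  cdim : nat;
  entries :> 'M[M]_(rdim, cdim)
}.

Definition col_tuple (M : Type) (a b : nat) (xi : 'M[M]_(a, b)) (j : 'I_b) :
  a.-tuple M := [tuple xi i j | i < a].

Definition columnwise (M N : Type) (a r b : nat)
    (F : a.-tuple M -> r.-tuple N) (xi : 'M[M]_(a, b)) : 'M[N]_(r, b) :=
  \matrix_(i < r, j < b) tnth (F (col_tuple xi j)) i.

(* [mxvec] concatenates the rows of a matrix, hence the transpositions. *)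
Definition vec (M : Type) (a b : nat) (xi : 'M[M]_(a, b)) : 'cV[M]_(b * a) :=
  trmx (mxvec (trmx xi)).

Definition unvec (M : Type) (a b : nat) (v : 'cV[M]_(b * a)) : 'M[M]_(a, b) :=
  trmx (vec_mx (trmx v)).

Lemma frag_dim (k q s : nat) : k * q * s = q * (k * s).
Proof. by rewrite (mulnC k) mulnA. Qed.

Definition Frag (M : Type) (k q s : nat) (xi : 'M[M]_(k * q, s)) :
    'M[M]_(q, k * s) :=
  trmx (unvec (castmx (frag_dim k q s, erefl 1) (vec (trmx xi)))).

(* The partial operators: None means "not applicable to this argument". *)

Definition trans_signal (c : nat) (M N : Type) (T : transformation c M N)
    (s : seq M) : option (seq N) :=
  omap (fun xi : signal c M => samples (T xi)) (insub s).

Definition stride_signal (k : nat) (M N : Type) (g : k.-tuple M -> N)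
    (s : seq M) : option (seq N) :=
  if (0 < size s) && (k %| size s) then Some (tval (Stride g (in_tuple s)))
  else None.

Lemma size_trans_tuple (c : nat) (M N : Type) (T : transformation c M N)
  (a : nat) (le_ca : c <= a) (s : a.-tuple M) :
  size (T (tuple_signal le_ca s)) == a - c + 1.
Proof. by case: (transP T) => -> _ /=; rewrite size_tuple. Qed.

Definition trans_tuple (c : nat) (M N : Type) (T : transformation c M N)
    (a : nat) (le_ca : c <= a) (s : a.-tuple M) : (a - c + 1).-tuple N :=
  Tuple (size_trans_tuple T le_ca s).

Definition trans_fsignal (c : nat) (M N : Type) (T : transformation c M N)
    (xi : fsignal M) : option (fsignal N) :=
  if @idP (c <= rdim xi) is ReflectT le_c then
    Some (FSignal (columnwise (trans_tuple T le_c) xi))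
  else None.

Definition slide_fsignal (k : nat) (M N : Type) (g : k.-tuple M -> N)
    (xi : fsignal M) : option (fsignal N) :=
  if k <= rdim xi then
    Some (FSignal (columnwise (Slide g (q := rdim xi)) xi))
  else None.

Lemma frag_rdim (k a b : nat) :
  [&& 0 < a, 0 < b & k %| a] -> a = k * (a %/ k).
Proof. by case/and3P=> _ _ dvd_ka; rewrite mulnC divnK. Qed.

Definition frag_fsignal (k : nat) (M : Type) (xi : fsignal M) :
    option (fsignal M) :=
  if @idP [&& 0 < rdim xi, 0 < cdim xi & k %| rdim xi] is ReflectT ok then
    Some (FSignal (Frag (castmx (frag_rdim ok, erefl (cdim xi)) xi)))
  else None.

Record layer (M M' : Type) := Layer {
  mid : Type;
  red : nat;
  red_gt0 : 0 < red;
  trans : transformation red M mid;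
  len : nat;
  len_gt0 : 0 < len;
  fn : len.-tuple mid -> M'
}.

(* [chain_layer P j] is the layer from M_j to M_(j+1): it consists of N_(j+1),
   c_(j+1), T_(j+1), k_(j+1) and g_(j+1) in the one-based numbering of layers.
   Only the layers with j < depth P belong to the chain; the families are
   indexed by all of nat merely for convenience, since every finite chain can be
   continued by constant layers into a one-point set. *)
Record processing_chain := ProcessingChain {
  input_dim : nat;
  input_dim_gt0 : 0 < input_dim;
  depth : nat;
  depth_gt0 : 0 < depth;
  chain_set : nat -> Type;
  chain_layer : forall j : nat, layer (chain_set j) (chain_set j.+1)
}.

(* k^*_j, the product of the stride lengths of the first j layers *)
Definition stride_prod (P : processing_chain) (j : nat) : nat :=
  \prod_(nu < j) len (chain_layer P nu).

Fixpoint EvalStride (P : processing_chain)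
    (rho : (input_dim P).-tuple (chain_set P 0)) (j : nat) :
    option (seq (chain_set P j)) :=
  match j return option (seq (chain_set P j)) with
  | 0 => Some (tval rho)
  | j'.+1 =>
      obind (stride_signal (@fn _ _ (chain_layer P j')))
        (obind (trans_signal (trans (chain_layer P j'))) (EvalStride rho j'))
  end.

Fixpoint EvalSlide (P : processing_chain) (D : nat)
    (xi : D.-tuple (chain_set P 0)) (j : nat) :
    option (fsignal (chain_set P j)) :=
  match j return option (fsignal (chain_set P j)) with
  | 0 => Some (FSignal (\col_(i < D) tnth xi i))
  | j'.+1 =>
      obind (@frag_fsignal (len (chain_layer P j')) _)
        (obind (slide_fsignal (@fn _ _ (chain_layer P j')))
          (obind (trans_fsignal (trans (chain_layer P j'))) (EvalSlide xi j')))
  end.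

Definition stride_well_defined (P : processing_chain) : Prop :=
  forall (j : nat) (rho : (input_dim P).-tuple (chain_set P 0)),
    1 <= j <= depth P ->
    exists2 eta : seq (chain_set P j),
      EvalStride rho j = Some eta & 0 < size eta.

(* Main.v *)
(* Put K = k*_j and let u be the length of EvalStride_j. By induction on j, for
   every 0-based position i the strided output on the subsignal starting at i is
   the subsignal of length u that starts at position i %/ K of the column i %% K
   of EvalSlide_j. A layer preserves this: with i %/ K = a, applying T_j keeps
   the position a, Stride reads the Slide output at a + k m, and Frag moves
   row a + k m = k (a %/ k + m) + a %% k of column i %% K to row a %/ k + m of
   column (a %% k) K + i %% K = i %% (k K). Divisibility of the row count by k
   follows since rdim + 1 - u = (D - B + 1) / K is a multiple of k and Stride is
   applicable. *)
Require Import Defs.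
From mathcomp Require Import all_boot all_order all_algebra.
From mathcomp Require Import zify ring lra.

Set Implicit Arguments.
Unset Strict Implicit.
Unset Printing Implicit Defensive.

Import GRing.Theory.
Local Open Scope ring_scope.

(** * Row-major positions and the entries of [Frag] *)

Lemma val_enum_rank (T : finType) (x : T) :
  enum_rank x = index x (enum T) :> nat.
Proof.
rewrite -{2}[x](nth_enum_rank x) index_uniq ?enum_uniq //.
by rewrite -cardE ltn_ord.
Qed.

Lemma index_allpairs (S T : eqType) (s : seq S) (t : seq T) x y :
  x \in s -> y \in t ->
  index (x, y) [seq (x1, x2) | x1 <- s, x2 <- t] =
    (index x s * size t + index y t)%N.
Proof.
move=> + yt; elim: s => //= z s IHs; rewrite in_cons => xzs.
have [eq_zx|neq_zx] := eqVneq z x.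
  rewrite index_cat -eq_zx map_f // mul0n index_map // => a b []; exact.
move: xzs; rewrite eq_sym (negbTE neq_zx) /= => xs.
rewrite index_cat size_map IHs // mulSn addnA ifF //.
by apply/negbTE/mapP => -[w _ [eq_xz _]]; rewrite eq_xz eqxx in neq_zx.
Qed.

Lemma val_mxvec_index (m n : nat) (i : 'I_m) (j : 'I_n) :
  mxvec_index i j = (i * n + j)%N :> nat.
Proof.
rewrite /mxvec_index /= val_enum_rank.
(* Unlocking the enumeration of a product type exposes the lexicographic list of pairs. *)
rewrite [enum _]enumT unlock /= [LHS]index_allpairs ?mem_enum //.
by rewrite !index_enum_ord size_enum_ord.
Qed.

(** The transpositions cancel those hidden in [vec] and [unvec], so [Frag] only cuts the row-by-row
    reading of [x] into rows of a new width; entries correspond when their flat positions agree. *)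
Lemma FragE (M : Type) (k q s : nat) (x : 'M[M]_(k * q, s))
    (a : 'I_q) (b : 'I_(k * s)) (r : 'I_(k * q)) (t : 'I_s) :
  (r * s + t = a * (k * s) + b)%N -> Frag x a b = x r t.
Proof.
move=> eq_pos; rewrite /Frag /unvec trmxK mxE [in LHS]mxE castmxE mxE trmxK.
rewrite -(mxvecE x); congr (mxvec x _ _); first exact: val_inj.
by apply: ord_inj; rewrite [LHS](val_mxvec_index a b) [RHS]val_mxvec_index.
Qed.

(** * The operators on subsignals and on columns *)

Lemma trans_signal_subsignal (c : nat) (M N : Type) (T : transformation c M N)
    (d a : nat) (s : seq M) (s' : seq N) :
  trans_signal T s = Some s' -> (c <= d)%N -> (a + d <= size s)%N ->
  trans_signal T (subsignal d s a) = Some (subsignal (d - c + 1) s' a).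
Proof.
case: (transP T) => _ compT; rewrite /trans_signal.
case: insubP => // xi _ def_s [<-] le_cd le_ad; rewrite -{}def_s in le_ad *.
have lt_a : (a < (size (samples xi)).+1 - d)%N by rewrite ltn_subRL ltnS addnC.
rewrite -[a]/(val (Ordinal lt_a)) -compT.
(* The raw subsignal is the underlying sequence of the bundled one, so [insub] returns the latter by
   [valK]. *)
suff -> : insub (subsignal d xi (Ordinal lt_a)) =
  Some (tuple_signal le_cd (Subsignal (in_tuple xi) (Ordinal lt_a))) by [].
exact: (valK (tuple_signal le_cd (Subsignal (in_tuple xi) (Ordinal lt_a)))).
Qed.

(** The dimensions of [w] are known only up to propositional equality. Matching column indices by
    value, here and in the two analogues below, avoids dependent casts. *)
Lemma trans_fsignalP (c : nat) (M N : Type) (T : transformation c M N)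
    (z : fsignal M) :
  (c <= rdim z)%N ->
  exists w : fsignal N, [/\ trans_fsignal T z = Some w,
    rdim w = (rdim z - c + 1)%N, cdim w = cdim z
    & forall (t : 'I_(cdim z)) (t' : 'I_(cdim w)), t' = t :> nat ->
      trans_signal T (col_tuple (entries z) t) =
        Some (tval (col_tuple (entries w) t'))].
Proof.
move=> le_c; rewrite /trans_fsignal; case: {-}_ / idP => // le_c'.
eexists; split => // t t' /val_inj ->.
rewrite /trans_signal (valK (tuple_signal le_c' (col_tuple (entries z) t))).
suff eq_col : trans_tuple T le_c' (col_tuple (entries z) t) =
    col_tuple (columnwise (trans_tuple T le_c') (entries z)) t.
  exact: (congr1 (fun y => Some (tval y)) eq_col).
by apply: eq_from_tnth => i; rewrite tnth_mktuple mxE.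
Qed.

Lemma slide_fsignalP (k : nat) (M N : Type) (g : k.-tuple M -> N)
    (z : fsignal M) :
  (k <= rdim z)%N ->
  exists w : fsignal N, [/\ slide_fsignal g z = Some w,
    rdim w = ((rdim z).+1 - k)%N, cdim w = cdim z
    & forall (t : 'I_(cdim z)) (t' : 'I_(cdim w)), t' = t :> nat ->
      Slide g (col_tuple (entries z) t) =
        col_tuple (entries w) t' :> seq N].
Proof.
move=> le_k; rewrite /slide_fsignal le_k.
eexists; split => // t t' /val_inj ->; congr tval.
by apply: eq_from_tnth => i; rewrite [RHS]tnth_mktuple mxE.
Qed.

Lemma frag_fsignalP (k : nat) (M : Type) (z : fsignal M) :
  (0 < rdim z)%N -> (0 < cdim z)%N -> (k %| rdim z)%N ->
  exists w : fsignal M, [/\ frag_fsignal k z = Some w,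
    rdim w = (rdim z %/ k)%N, cdim w = (k * cdim z)%N
    & forall (r : 'I_(rdim z)) (t : 'I_(cdim z))
        (r' : 'I_(rdim w)) (t' : 'I_(cdim w)),
      (r * cdim z + t = r' * (k * cdim z) + t')%N ->
      entries z r t = entries w r' t'].
Proof.
move=> r_gt0 c_gt0 dvd_k; rewrite /frag_fsignal; case: {-}_ / idP; last first.
  by rewrite r_gt0 c_gt0 dvd_k.
move=> ok; eexists; split => //= r t r' t' eq_pos.
rewrite (@FragE _ _ _ _ _ r' t' (cast_ord (frag_rdim ok) r) t) //.
by rewrite castmxE /= cast_ordK cast_ord_id.
Qed.

Lemma subsignal_subsignal (M : Type) (k d a i : nat) (s : seq M) :
  (i + k <= d)%N -> subsignal k (subsignal d s a) i = subsignal k s (a + i).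
Proof.
move=> le_d; rewrite /subsignal take_drop take_takel; last by rewrite addnC.
by rewrite -take_drop drop_drop addnC.
Qed.

(** The window at [k * m] inside the subsignal is the window of [y] at [a + k * m], so striding
    picks every [k]-th Slide value from [a] on. *)
Lemma stride_signal_subsignal (k d n a : nat) (M N : Type)
    (g : k.-tuple M -> N) (y : n.-tuple M) :
  (0 < d)%N -> (k %| d)%N -> (a + d <= n)%N ->
  exists w : seq N, [/\ stride_signal g (subsignal d y a) = Some w,
    size w = (d %/ k)%N
    & forall x0 m, (m < d %/ k)%N -> nth x0 w m = nth x0 (Slide g y) (a + k * m)].
Proof.
move=> d_gt0 dvd_k le_n; rewrite /stride_signal.
have sz_d : size (subsignal d y a) = d.
  by rewrite size_takel // size_drop size_tuple; lia.
rewrite ifT; last by rewrite sz_d d_gt0.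
eexists; split=> [//||x0 m lt_m].
  by rewrite size_tuple sz_d.
have lt_m' : (m < size (subsignal d y a) %/ k)%N by rewrite sz_d.
have le_km : (k * m + k <= d)%N.
  by rewrite -mulnSr -(divnK dvd_k) mulnC leq_mul2r lt_m orbT.
have lt_s : (a + k * m < n.+1 - k)%N by lia.
rewrite -[m in LHS]/(val (Ordinal lt_m')) nth_mktuple.
rewrite -[(a + _)%N]/(val (Ordinal lt_s)) nth_mktuple; congr g.
by apply: val_inj; rewrite /= subsignal_subsignal.
Qed.

(** Here [n] counts the positions of length-[u] subsignals in a column. The layer divides it by [k],
    and the row equation keeps its shape, so the step can be iterated. *)
Lemma layer_step (M M' : Type) (ly : layer M M') (z : fsignal M) (u n : nat) :
  let c := red ly in let k := len ly in
  (c <= u)%N -> (k %| u - c + 1)%N -> (0 < n)%N -> (k %| n)%N ->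
  (rdim z + 1 = u + n)%N -> (0 < cdim z)%N ->
  exists z' : fsignal M',
    [/\ obind (@frag_fsignal k M') (obind (slide_fsignal (@fn _ _ ly))
          (trans_fsignal (trans ly) z)) = Some z',
        (rdim z' + 1 = (u - c + 1) %/ k + n %/ k)%N, cdim z' = (k * cdim z)%N
      & forall (a : nat) (t : 'I_(cdim z)) (t' : 'I_(cdim z')),
          (a < n)%N -> t' = (a %% k * cdim z + t)%N :> nat ->
          obind (stride_signal (@fn _ _ ly)) (trans_signal (trans ly)
            (subsignal u (col_tuple (entries z) t) a)) =
          Some (subsignal ((u - c + 1) %/ k)
            (col_tuple (entries z') t') (a %/ k))].
Proof.
move=> c k le_cu dvd_ku n_gt0 dvd_kn eq_rdim c_gt0.
have k_gt0 : (0 < k)%N := len_gt0 ly.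
case/dvdnP: dvd_ku => u' eq_u'; case/dvdnP: dvd_kn => n' eq_n'.
have u'_gt0 : (0 < u')%N by case: u' eq_u' => //; lia.
have n'_gt0 : (0 < n')%N by case: n' eq_n' => //; lia.
have eq_nk : (n %/ k = n')%N by rewrite eq_n' mulnK.
rewrite eq_nk eq_u' mulnK //.
have [|w [def_w rdim_w cdim_w wP]] := trans_fsignalP (trans ly) (z := z); first lia.
have [|x [def_x rdim_x cdim_x xP]] := slide_fsignalP (@fn _ _ ly) (z := w).
  by rewrite rdim_w -/c -/k; nia.
(* T and Slide remove [c - 1] and [k - 1] rows from [u' * k + (c - 1) + n' * k - 1], which leaves a
   multiple of [k]. *)
have eq_x : rdim x = (k * (u' + n' - 1))%N by rewrite rdim_x rdim_w -/c -/k; nia.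
have [||| z' [def_z' rdim_z' cdim_z' z'P]] := @frag_fsignalP k _ x.
- by rewrite eq_x; nia.
- by rewrite cdim_x cdim_w.
- by rewrite eq_x dvdn_mulr.
rewrite eq_x mulKn // in rdim_z'; rewrite cdim_x cdim_w in cdim_z'.
exists z'; split=> [||//|a t t' lt_a eq_t'].
- by rewrite def_w /= def_x.
- by rewrite rdim_z'; lia.
have lt_tw : (t < cdim w)%N by rewrite cdim_w.
have lt_tx : (t < cdim x)%N by rewrite cdim_x.
rewrite (trans_signal_subsignal (wP t (Ordinal lt_tw) erefl)) //; last first.
  by rewrite size_tuple; lia.
rewrite -/c /= eq_u'.
have [|||v [-> size_v vP]] := @stride_signal_subsignal k (u' * k) _ a _ _
  (@fn _ _ ly) (col_tuple (entries w) (Ordinal lt_tw)).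
- by rewrite muln_gt0 u'_gt0.
- by rewrite dvdn_mull.
- by rewrite rdim_w -/c; lia.
rewrite mulnK // in size_v vP; congr Some.
have lt_ak : (a %/ k < n')%N by rewrite ltn_divLR // -eq_n'.
have size_r : size (subsignal u' (col_tuple (entries z') t') (a %/ k)) = u'.
  by rewrite size_takel // size_drop size_tuple rdim_z'; lia.
have rz_gt0 : (0 < rdim z')%N by rewrite rdim_z'; lia.
(* The top entry of column [t'] serves as default value. *)
apply: (@eq_from_nth _ (entries z' (Ordinal rz_gt0) t')); rewrite size_v ?size_r //.
move=> m lt_m; rewrite vP // (xP (Ordinal lt_tw) (Ordinal lt_tx) erefl).
rewrite /subsignal nth_take // nth_drop.
have lt_r : (a %/ k + m < rdim z')%N by rewrite rdim_z'; lia.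
have lt_x : (a + k * m < rdim x)%N by rewrite eq_x; nia.
rewrite -[(a + _)%N]/(val (Ordinal lt_x)) nth_mktuple.
rewrite -[(_ + m)%N]/(val (Ordinal lt_r)) nth_mktuple.
(* With [s = cdim z], both flat positions equal [k * s * (a %/ k + m) + s * (a %% k) + t]. *)
apply: z'P; rewrite /= eq_t' cdim_x cdim_w.
by rewrite {1}(divn_eq a k); ring.
Qed.

(** One successful strided evaluation yields conditions on the length alone, which then transfer to
    every signal of that length. *)
Lemma layer_stride_applicable (M M' : Type) (ly : layer M M') (s : seq M)
    (eta : seq M') :
  obind (stride_signal (@fn _ _ ly)) (trans_signal (trans ly) s) = Some eta ->
  (red ly <= size s)%N /\ (len ly %| size s - red ly + 1)%N.
Proof.
rewrite /trans_signal; case: insubP => //= y + def_s; rewrite -{}def_s => le_red.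
rewrite /stride_signal; case: ifP => // /andP[_ dvd_len] _; split=> //.
by have [sz_T _] := transP (trans ly); rewrite sz_T in dvd_len.
Qed.

(** * Stride products and the induction over layers *)

Lemma stride_prodS (P : processing_chain) (j : nat) :
  stride_prod P j.+1 = (stride_prod P j * len (chain_layer P j))%N.
Proof. by rewrite /stride_prod big_ord_recr. Qed.

Lemma stride_prod_gt0 (P : processing_chain) (j : nat) :
  (0 < stride_prod P j)%N.
Proof. by rewrite prodn_gt0 // => nu; apply: len_gt0. Qed.

Lemma dvdn_stride_prod (P : processing_chain) (j l : nat) :
  (j <= l)%N -> (stride_prod P j %| stride_prod P l)%N.
Proof.
move=> /subnKC <-; elim: (l - j)%N => [|d IHd]; first by rewrite addn0.
by rewrite addnS stride_prodS dvdn_mulr.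
Qed.

(** The two equations are (c) and (a) multiplied by [K], hence free of division. Well-definedness
    belongs to the same induction, since applicability of the next layer depends on [u] and the row
    count. *)
Lemma EvalSlide_invariant (P : processing_chain) (D : nat)
    (xi : D.-tuple (chain_set P 0)) (j : nat) :
  stride_well_defined P ->
  (input_dim P <= D)%N ->
  (stride_prod P (depth P) %| D - input_dim P + 1)%N ->
  (j <= depth P)%N ->
  let K := stride_prod P j in
  exists zeta u, [/\ EvalSlide xi j = Some zeta, (0 < u)%N, cdim zeta = K,
    (K * (rdim zeta + 1) = K * u + (D - input_dim P + 1))%N /\
    (K * u + \sum_(mu < j) stride_prod P mu * (red (chain_layer P mu) - 1) =
      input_dim P)%N
    & forall (i : 'I_(D.+1 - input_dim P)) (t : 'I_(cdim zeta)),
        t = (i %% K)%N :> nat ->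
        EvalStride (Subsignal xi i) j =
          Some (subsignal u (col_tuple (entries zeta) t) (i %/ K))].
Proof.
move=> wd le_BD dvd_K; have B_gt0 := input_dim_gt0 P.
elim: j => [_|j IHj lt_j] /=.
  rewrite /stride_prod !big_ord0.
  do 2!eexists; split; [by []|exact: B_gt0|by []|by rewrite /=; lia|].
  move=> i t _ /=; rewrite divn1; congr Some; rewrite /subsignal; congr take.
  congr drop; 
  suff eq_xi : xi = col_tuple (\col_(i0 < D) tnth xi i0) t by exact: congr1 eq_xi.
  by apply: eq_from_tnth => m; rewrite tnth_mktuple mxE.
have [z [u [def_z u_gt0 cdim_z [rdim_z sum_red] evalP]]] := IHj (ltnW lt_j).
have K_gt0 := stride_prod_gt0 P j; have k_gt0 := len_gt0 (chain_layer P j).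
have [n eq_n] : exists n,
    (D - input_dim P + 1 = n * (stride_prod P j * len (chain_layer P j)))%N.
  apply/dvdnP; rewrite -stride_prodS.
  exact: dvdn_trans (dvdn_stride_prod _ lt_j) dvd_K.
set K := stride_prod P j in K_gt0 *; set ly := chain_layer P j in k_gt0 eq_n *.
have rdim_z' : (rdim z + 1 = u + n * len ly)%N.
  by apply/eqP; rewrite -(eqn_pmul2l K_gt0) rdim_z eq_n; apply/eqP; ring.
have lt_iK (i : 'I_(D.+1 - input_dim P)) : (i %/ K < n * len ly)%N.
  by rewrite ltn_divLR //; have := ltn_ord i; nia.
have size_sub (i : 'I_(D.+1 - input_dim P)) (t : 'I_(cdim z)) :
    size (subsignal u (col_tuple (entries z) t) (i %/ K)) = u.
  by rewrite size_takel // size_drop size_tuple; have := lt_iK i; lia.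
have lt_mod i : (i %% K < cdim z)%N by rewrite cdim_z ltn_pmod.
(* Both facts are read off at position 0, which is admissible because [input_dim P <= D]. *)
have [le_red dvd_len] : (red ly <= u)%N /\ (len ly %| u - red ly + 1)%N.
  have lt_0 : (0 < D.+1 - input_dim P)%N by lia.
  have := evalP _ (Ordinal (lt_mod (Ordinal lt_0))) erefl.
  have := size_sub (Ordinal lt_0) (Ordinal (lt_mod (Ordinal lt_0))).
  move: (subsignal _ _ _) => s <- def_s.
  have [eta /=] := wd j.+1 (Subsignal xi (Ordinal lt_0)) lt_j.
  by rewrite def_s => /layer_stride_applicable.
have n_gt0 : (0 < n)%N by case: n eq_n {rdim_z' lt_iK size_sub} => //; lia.
have [|||z' [def_z' rdim_z'' cdim_z' stepP]] := layer_step le_red dvd_len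
  _ _ rdim_z' _.
- by rewrite muln_gt0 n_gt0.
- exact: dvdn_mull.
- by rewrite cdim_z.
exists z', ((u - red ly + 1) %/ len ly)%N; rewrite stride_prodS -/K -/ly.
rewrite mulnK // in rdim_z''; split.
- rewrite def_z /= -def_z'; case: trans_fsignal => //.
- by rewrite divn_gt0 // dvdn_leq // addn1.
- by rewrite cdim_z' cdim_z mulnC.
- have eq_u : (K * len ly * ((u - red ly + 1) %/ len ly) =
      K * (u - red ly + 1))%N by rewrite -mulnA (mulnC (len ly)) divnK.
  split; first by rewrite rdim_z'' mulnDr eq_n; congr addn; ring.
  rewrite big_ord_recr /= -/K -/ly eq_u -[RHS]sum_red.
  have eq_ur : u = (u - red ly + 1 + (red ly - 1))%N.
    by have := red_gt0 ly; lia.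
  by rewrite [in RHS]eq_ur; ring.
move=> i t' eq_t'.
rewrite (evalP i (Ordinal (lt_mod i)) erefl) /= (stepP _ _ t' (lt_iK i)) //=.
  by rewrite divnMA.
(* Adding the quotient part of [i] modulo [K * len ly] turns both sides into [i]. *)
apply/eqP; rewrite -(eqn_add2l (i %/ (K * len ly) * (K * len ly))).
apply/eqP; rewrite eq_t' -divn_eq.
rewrite cdim_z -/K {1}(divn_eq i K) {1}(divn_eq (i %/ K) (len ly)) divnMA.
by ring.
Qed.

Theorem lemma4 (P : processing_chain) (D : nat)
    (xi : D.-tuple (chain_set P 0)) :
  stride_well_defined P ->
  (0 < D)%N ->
  (input_dim P <= D)%N ->
  (stride_prod P (depth P) %| D - input_dim P + 1)%N ->
  (forall j : nat, (j <= depth P)%N ->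
     exists zeta : fsignal (chain_set P j), EvalSlide xi j = Some zeta) /\
  (forall j : nat, (j <= depth P)%N ->
     exists u : nat,
       [/\ (0 < u)%N,
           forall i : 'I_(D.+1 - input_dim P),
             exists2 eta : seq (chain_set P j),
               EvalStride (Subsignal xi i) j = Some eta & size eta = u
         & forall zeta : fsignal (chain_set P j), EvalSlide xi j = Some zeta ->
           [/\ (* (a) *)
               u%:R = (stride_prod P j)%:R^-1 *
                 ((input_dim P)%:R
                  - \sum_(mu < j) (stride_prod P mu)%:R *
                      ((red (chain_layer P mu))%:R - 1)) :> rat,
               (* (b) *)
               (rdim zeta)%:R = (stride_prod P j)%:R^-1 *
                 (D%:R - (stride_prod P j)%:R + 1
                  - \sum_(mu < j) (stride_prod P mu)%:R *
                      ((red (chain_layer P mu))%:R - 1)) :> rat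
               /\ cdim zeta = stride_prod P j,
               (* (c) *)
               (rdim zeta)%:R - u%:R + 1 =
                 (stride_prod P j)%:R^-1 *
                 (D%:R - (input_dim P)%:R + 1) :> rat
             & (* (d) *)
               forall (i : 'I_(D.+1 - input_dim P))
                   (eta : seq (chain_set P j)) (m : 'I_(size eta)),
                 EvalStride (Subsignal xi i) j = Some eta ->
                 exists (r : 'I_(rdim zeta)) (t : 'I_(cdim zeta)),
                   [/\ r = (i %/ stride_prod P j + m)%N :> nat,
                       t = (i %% stride_prod P j)%N :> nat
                     & tnth (in_tuple eta) m = entries zeta r t]]]).
Proof.
move=> wd _ le_BD dvd_K.
have inv j := EvalSlide_invariant xi (j := j) wd le_BD dvd_K.
split=> j le_j; have [z [u [def_z u_gt0 cdim_z [rdim_z sum_red] evalP]]] :=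
  inv j le_j; first by exists z.
have K_gt0 := stride_prod_gt0 P j.
set K := stride_prod P j in K_gt0 cdim_z rdim_z sum_red evalP *.
have lt_mod i : (i %% K < cdim z)%N by rewrite cdim_z ltn_pmod.
have le_i (i : 'I_(D.+1 - input_dim P)) : (i %/ K + u <= rdim z)%N.
  (* After multiplication by [K] the bound reduces to [i %/ K * K <= i < D - input_dim P + 1]. *)
  rewrite -ltnS -[(rdim z).+1]addn1 -(ltn_pmul2l K_gt0) rdim_z mulnDr addnC.
  rewrite ltn_add2l mulnC; apply: leq_ltn_trans (leq_divM _ _) _.
  by have := ltn_ord i; lia.
have size_sub (i : 'I_(D.+1 - input_dim P)) (t : 'I_(cdim z)) :
    size (subsignal u (col_tuple (entries z) t) (i %/ K)) = u.
  by rewrite size_takel // size_drop size_tuple; have := le_i i; lia.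
exists u; split=> // [i|zeta].
  by rewrite (evalP i (Ordinal (lt_mod i)) erefl); eexists.
rewrite def_z => -[<-] {zeta}.
(* Truncated and rational differences agree because every [red] is at least 1. *)
have -> : \sum_(mu < j) (stride_prod P mu)%:R *
    ((red (chain_layer P mu))%:R - 1) =
  (\sum_(mu < j) stride_prod P mu * (red (chain_layer P mu) - 1))%:R :> rat.
  rewrite natr_sum; apply: eq_bigr => mu _.
  by rewrite natrM natrB ?red_gt0.
set S := (\sum_(_ < j) _)%N in sum_red *.
have K_neq0 : K%:R != 0 :> rat by rewrite Num.Theory.pnatr_eq0 -lt0n.
have B_eq : (input_dim P)%:R = K%:R * u%:R + S%:R :> rat.
  by rewrite -sum_red natrD natrM.
have r_eq : K%:R * ((rdim z)%:R + 1) =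
    K%:R * u%:R + (D%:R - (input_dim P)%:R + 1) :> rat.
  have /(congr1 (fun n => n%:R : rat)) := rdim_z.
  by rewrite !(natrD, natrM) natrB.
split.
- by rewrite B_eq addrK mulKf.
- split=> //; apply: (mulfI K_neq0); rewrite mulVKf //.
  by rewrite B_eq in r_eq; lra.
- by apply: (mulfI K_neq0); rewrite mulVKf //; lra.
move=> i eta m; rewrite (evalP i (Ordinal (lt_mod i)) erefl) => -[def_eta].
(* The type of [m] mentions [eta], so [m] is generalized while [eta] is replaced. *)
case: _ / def_eta m => m.
have lt_m := leq_trans (ltn_ord m) (eq_leq (size_sub i (Ordinal (lt_mod i)))).
have lt_r : (i %/ K + m < rdim z)%N by have := le_i i; lia.
exists (Ordinal lt_r), (Ordinal (lt_mod i)); split=> //.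
rewrite (tnth_nth (entries z (Ordinal lt_r) (Ordinal (lt_mod i)))) /=.
rewrite /subsignal nth_take // nth_drop.
by rewrite -[(_ + m)%N]/(val (Ordinal lt_r)) nth_mktuple.
Qed.
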